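(* Let $\mathsf{PLANAR}$ be the set of all values of $\chi((\mathbb{R}^2,\rho),\{1\})$, where $\rho$ runs over all planar metrics. Then $\mathsf{PLANAR} = \mathbb{N}\cup\{\aleph_0\}$, where $\mathbb{N}=\{1,2,3,\dots\}$.
   Context: A planar metric is a metric $\rho$ on $\mathbb{R}^2$ that is translation invariant, i.e. $\rho(x,y)=\rho(x+v,y+v)$ for all $x,y,v\in\mathbb{R}^2$, and that induces the usual (Euclidean) topology on $\mathbb{R}^2$. For a metric space $(X,\rho)$ and $D\subset(0,\infty)$, the distance graph $G(X,D)$ has vertex set $X$, with $x,y$ adjacent iff $\rho(x,y)\in D$; $\chi(X,D)$ denotes its chromatic number. Convention on chromatic numbers: $\chi=k\in\mathbb{N}$ if there is a proper coloring with $k$ colors and $k$ is minimal; $\chi\le\aleph_0$ if there is a proper coloring with values in $\mathbb{N}$, and $\chi=\aleph_0$ if moreover there is no proper coloring with finitely many colors. *)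

(* Defs.v *)
From HB Require Import structures.
From mathcomp Require Import all_boot all_order all_algebra.
From mathcomp Require Import all_classical all_reals all_analysis.
Import Order.TTheory GRing.Theory Num.Theory.
Import numFieldNormedType.Exports.

Set Implicit Arguments.
Unset Strict Implicit.
Unset Printing Implicit Defensive.

Local Open Scope classical_set_scope.
Local Open Scope ring_scope.

(* The axioms are those of the factory isMetric of MathComp-Analysis, stated
   for a function so that several metrics can live on the same type. *)
Record is_metric (R : realType) (X : Type) (rho : X -> X -> R) : Prop := {
  is_metric_xx : forall x, rho x x = 0 ;
  is_metric_eq : forall x y, rho x y = 0 -> x = y ;
  is_metric_sym : forall x y, rho x y = rho y x ;
  is_metric_triangle : forall y x z, rho x z <= rho x y + rho y z }.

Definition metric_ball (R : realType) (X : Type) (rho : X -> X -> R)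
    (x : X) (e : R) : set X :=
  [set y | rho x y < e].

Definition metric_open (R : realType) (X : Type) (rho : X -> X -> R)
    (A : set X) : Prop :=
  forall x, A x -> exists2 e : R, 0 < e & metric_ball rho x e `<=` A.

(* [open] refers to the product topology of R * R. *)
Record planar_metric (R : realType) (rho : R * R -> R * R -> R) : Prop := {
  planar_is_metric : is_metric rho ;
  planar_translation : forall x y v : R * R, rho x y = rho (x + v) (y + v) ;
  planar_topology : forall A : set (R * R), metric_open rho A <-> open A }.

Definition distance_graph (R : realType) (X : Type) (rho : X -> X -> R)
    (D : set R) (x y : X) : Prop :=
  D (rho x y).

Definition colorable (V : Type) (E : V -> V -> Prop) (C : Type) : Prop :=
  exists c : V -> C, forall x y, E x y -> c x <> c y.

(* All uncountable cardinals are merged into the single value [Uncountable]. *)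
Inductive chromatic_value : Type :=
| Finite_chi of nat
| Aleph0
| Uncountable.

Definition chromatic_number (V : Type) (E : V -> V -> Prop) : chromatic_value :=
  match pselect (exists k : nat, `[< colorable E 'I_k >]) with
  | left finite_col => Finite_chi (ex_minn finite_col)
  | right _ => if `[< colorable E nat >] then Aleph0 else Uncountable
  end.

Definition PLANAR (R : realType) : set chromatic_value :=
  [set chromatic_number (distance_graph rho [set (1 : R)])
    | rho in @planar_metric R].

(* Main.v *)
Require Import Defs.
From mathcomp Require Import all_boot all_order all_algebra.
From mathcomp Require Import all_classical all_reals all_analysis.
From mathcomp Require Import lra zify.
Import Order.TTheory GRing.Theory Num.Theory.
Import numFieldNormedType.Exports.

(** Write a translation invariant metric as [len (y - x)].  If a 1-Lipschitz even
    function [bump] takes values in [1/2, 1], then [min |v| (bump v)] is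
    subadditive: two large vectors already have total length at least 1.  Hence a
    symmetric uniformly discrete set [S] gives a planar metric whose unit sphere
    consists of the points of [S] of norm at least 1.  For [S] the set of
    the points (m, 0) with m an integer and |m| < k the unit-distance graph has
    the k-clique (0, 0), ..., (k - 1, 0) and the colouring [floor x.1 mod k]; for
    [S] the set of all (m, 0) it has cliques of every finite size.  Countably many
    colours always suffice: colour the cells of a fine enough square grid. *)

Set Implicit Arguments.
Unset Strict Implicit.
Unset Printing Implicit Defensive.

Local Open Scope classical_set_scope.
Local Open Scope ring_scope.

(** * The truncated norm of a symmetric uniformly discrete set *)

Section TruncatedNorm.
Variables (R : realType) (V : normedModType R) (S : set V).
Hypothesis S0 : S 0.
Hypothesis SN : forall s, S s -> S (- s).
Hypothesis S_discrete : forall s t, S s -> S t -> `|s - t| < 1 -> s = t.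

Definition gap (v : V) : R := inf [set `|v - s| | s in S].

Lemma has_inf_gap v : has_inf [set `|v - s| | s in S].
Proof.
split; first by exists `|v - 0|, 0.
by exists 0 => _ [s _ <-].
Qed.

Lemma gap_ge0 v : 0 <= gap v.
Proof. by apply: lb_le_inf; [case: (has_inf_gap v) | move=> _ [s _ <-]]. Qed.

Lemma gap_le v s : S s -> gap v <= `|v - s|.
Proof.
move=> Ss; apply: ge_inf; first by case: (has_inf_gap v).
by exists s.
Qed.

Lemma gap_lipschitz u v : gap (u + v) <= `|u| + gap v.
Proof.
rewrite -lerBlDl; apply: lb_le_inf; first by case: (has_inf_gap v).
move=> _ [s Ss <-]; rewrite lerBlDl.
by apply: (le_trans (gap_le _ Ss)); rewrite -addrA ler_normD.
Qed.

Lemma gapN v : gap (- v) = gap v.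
Proof.
have gapN_le w : gap w <= gap (- w).
  apply: lb_le_inf; first by case: (has_inf_gap (- w)).
  move=> _ [s Ss <-].
  by rewrite -normrN opprD opprK; apply/gap_le/SN.
by apply/eqP; rewrite eq_le gapN_le -{2}(opprK v) gapN_le.
Qed.

Lemma gap_eq0 v : gap v = 0 <-> S v.
Proof.
split=> [v0|Sv]; last first.
  apply/eqP; rewrite eq_le gap_ge0 andbT.
  by rewrite (le_trans (gap_le v Sv))// subrr normr0.
have approx e : 0 < e -> exists2 s, S s & `|v - s| < e.
  move=> e0; have [_ [s Ss <-]] := inf_adherent e0 (has_inf_gap v).
  by rewrite -/(gap v) v0 add0r => vs; exists s.
(* If [v] differs from [s], some [t] in [S] is strictly nearer to [v]. Both lie within 1/2 of [v],
   so discreteness forces [s = t], a contradiction. *)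
have [s Ss vs] := approx 2^-1 ltac:(lra).
have [-> //|sv] := eqVneq v s.
have [|t St vt] := approx `|v - s|; first by rewrite normr_gt0 subr_eq0.
suff st : s = t by move: vt; rewrite st ltxx.
apply: S_discrete => //.
have : `|s - t| <= `|s - v| + `|v - t| by exact: ler_distD.
rewrite (distrC s v); lra.
Qed.

(** The cutoff at 1/2 makes any two values add up to at least 1, the maximum of [bump]. *)
Definition bump (v : V) : R := Num.max 2^-1 (1 - gap v).

Lemma bump_ge v : 2^-1 <= bump v.
Proof. by rewrite le_max lexx. Qed.

Lemma bump_le1 v : bump v <= 1.
Proof. by rewrite ge_max; have := gap_ge0 v; lra. Qed.

Lemma bump_lipschitz u v : bump (u + v) <= `|u| + bump v.
Proof.
(* Writing [v] as [- u + (u + v)] bounds [gap (u + v)] from below. *)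
have := gap_lipschitz (- u) (u + v); rewrite addKr normrN => uv.
have u0 := normr_ge0 u.
have b2 := bump_ge v.
have b1 : 1 - gap v <= bump v by rewrite le_max lexx orbT.
by rewrite ge_max; lra.
Qed.

Lemma bump_eq1 v : bump v = 1 <-> S v.
Proof.
rewrite -gap_eq0 /bump; split=> [|->]; last first.
  by rewrite subr0; apply/max_idPr; lra.
by have g0 := gap_ge0 v; case: (leP 2^-1); lra.
Qed.

Definition len (v : V) : R := Num.min `|v| (bump v).

Lemma len_le_norm v : len v <= `|v|.
Proof. by rewrite ge_min lexx. Qed.

Lemma len_small v : len v < 2^-1 -> len v = `|v|.
Proof. by rewrite /len; have b := bump_ge v; case: (leP `|v|); lra. Qed.

Lemma len0 : len 0 = 0.
Proof. by rewrite /len normr0; apply/min_idPl; have := bump_ge 0; lra. Qed.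

Lemma len_eq0 v : len v = 0 -> v = 0.
Proof.
move=> v0; apply/normr0_eq0; rewrite -len_small// v0; lra.
Qed.

Lemma lenN v : len (- v) = len v.
Proof. by rewrite /len normrN /bump gapN. Qed.

(** Two norms: the triangle inequality. A norm and a bump: [bump] is 1-Lipschitz. Two bumps: their
    sum is at least 1, which bounds [bump (u + v)]. *)
Lemma len_triangle u v : len (u + v) <= len u + len v.
Proof.
have b := bump_le1 (u + v).
have buv := bump_lipschitz u v.
have bvu := bump_lipschitz v u; rewrite addrC in bvu.
have nuv := ler_normD u v.
have bu := bump_ge u.
have bv := bump_ge v.
have ln : len (u + v) <= `|u + v| := len_le_norm _.
have lb : len (u + v) <= bump (u + v) by rewrite ge_min lexx orbT.
rewrite {2 3}/len; case: (leP `|u|) => _; case: (leP `|v|) => _; lra.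
Qed.

Lemma len_eq1 v : len v = 1 <-> S v /\ 1 <= `|v|.
Proof.
have b := bump_le1 v; rewrite -bump_eq1 /len.
by split=> [|[-> v1]]; [case: (leP `|v|); lra | exact/min_idPr].
Qed.

Definition len_dist (x y : V) : R := len (y - x).

Lemma len_dist_metric : is_metric len_dist.
Proof.
split=> [x|x y|x y|y x z]; rewrite /len_dist.
- by rewrite subrr len0.
- by move=> /len_eq0/subr0_eq ->.
- by rewrite -lenN opprB.
- by rewrite [leRHS]addrC -(subrKA y z) len_triangle.
Qed.

(** Below 1/2, [len] is the norm, so small balls coincide. *)
Lemma len_dist_open A : metric_open len_dist A <-> open A.
Proof.
rewrite openE; split=> oA x Ax.
- have [e e0 eA] := oA _ Ax.
  apply/nbhs_ballP; exists e => //= y; rewrite -ball_normE /= => xy.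
  by apply: eA; rewrite /metric_ball/= (le_lt_trans (len_le_norm _))// distrC.
- have /nbhs_ballP[e /= e0 eA] := oA _ Ax.
  exists (Num.min e 2^-1); first by rewrite lt_min e0/=; lra.
  move=> y; rewrite /metric_ball /= lt_min => /andP[xe x2].
  by apply: eA; rewrite -ball_normE /= distrC -len_small.
Qed.

End TruncatedNorm.

(** * Chromatic numbers and cliques *)

Section ChromaticNumber.
Variables (V : Type) (E : V -> V -> Prop).

Lemma chromatic_number_finite k :
  colorable E 'I_k -> (forall j, colorable E 'I_j -> (k <= j)%N) ->
  chromatic_number E = Finite_chi k.
Proof.
move=> Ek k_min; rewrite /chromatic_number.
case: pselect => [ex|[]]; last by exists k; apply/asboolP.
case: ex_minnP => j /asboolP Ej j_min; congr Finite_chi.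
by apply/eqP; rewrite eqn_leq k_min// j_min//; apply/asboolP.
Qed.

Lemma chromatic_number_aleph0 :
  (forall j, ~ colorable E 'I_j) -> colorable E nat ->
  chromatic_number E = Aleph0.
Proof.
move=> noE Enat; rewrite /chromatic_number.
case: pselect => [ex|_]; last by rewrite asboolT.
by exfalso; case: ex => j /asboolP/noE.
Qed.

Lemma colorable_clique k j (p : 'I_k -> V) :
  (forall a b, a != b -> E (p a) (p b)) -> colorable E 'I_j -> (k <= j)%N.
Proof.
move=> clique [c cP]; rewrite -(card_ord k) -(card_ord j).
apply: (@leq_card _ _ (c \o p)) => a b cab; apply/eqP.
by apply/negPn/negP => /clique/cP; apply.
Qed.

End ChromaticNumber.

(** * Countable colourings and metrics from integer points on an axis *)

Section Planar.
Variable R : realType.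

Lemma floor_eq_dist (x y : R) : Num.floor x = Num.floor y -> `|x - y| < 1.
Proof.
move=> xy.
have := floor_le x; have := floorD1_gt x.
have := floor_le y; have := floorD1_gt y.
by rewrite xy ltr_norml !intrD; lra.
Qed.

Lemma planar_colorable_nat (rho : R * R -> R * R -> R) :
  planar_metric rho -> colorable (distance_graph rho [set (1 : R)]) nat.
Proof.
move=> [[rho_xx _ _ rho_tri] rhoD rho_open].
have : open (metric_ball rho 0 1).
  apply/rho_open => x; rewrite /metric_ball /= => x1.
  exists (1 - rho 0 x); first by rewrite subr_gt0.
  by move=> y /=; have := rho_tri x 0 y; lra.
rewrite openE => /(_ 0); rewrite /metric_ball /= rho_xx ltr01 => /(_ isT).
move=> /nbhs_ballP[e /= e0 eB].
(* Points of one cell differ by less than [e] in each coordinate, so their difference lies in the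
   unit ball of [rho]. *)
pose cell (x : R * R) := (Num.floor (x.1 / e), Num.floor (x.2 / e)).
exists (pickle \o cell) => x y /= rxy /(pcan_inj pickleK) [c1 c2].
have close a b : Num.floor (a / e) = Num.floor (b / e) -> `|0 - (b - a)| < e.
  move=> /floor_eq_dist; rewrite -mulrBl normrM normfV (gtr0_norm e0).
  by rewrite ltr_pdivrMr// mul1r sub0r opprB.
suff: rho x y < 1 by rewrite rxy ltxx.
rewrite (rhoD _ _ (- x)) subrr; apply: eB.
by split; rewrite -ball_normE /=; apply: close.
Qed.

Definition axis_points (K : set int) : set (R * R) :=
  [set ((m%:~R : R), (0 : R)) | m in K].

Section AxisMetric.
Variable K : set int.
Hypothesis K0 : K 0.
Hypothesis KN : forall m, K m -> K (- m).

Lemma axis_points0 : axis_points K 0.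
Proof. by exists 0. Qed.

Lemma axis_pointsN s : axis_points K s -> axis_points K (- s).
Proof.
move=> [m Km <-]; exists (- m); first exact: KN.
by rewrite intrN -[RHS]/(- _, - _) oppr0.
Qed.

Lemma axis_points_discrete s t :
  axis_points K s -> axis_points K t -> `|s - t| < 1 -> s = t.
Proof.
move=> [m _ <-] [n _ <-]; rewrite prod_normE /= gt_max => /andP[+ _].
rewrite -intrB -intr_norm ltrz1 => mn.
by congr (_ %:~R, _); lia.
Qed.

Definition axis_metric : R * R -> R * R -> R := len_dist (axis_points K).

Lemma axis_metric_planar : planar_metric axis_metric.
Proof.
split.
- exact: len_dist_metric axis_points0 axis_pointsN.
- by move=> x y v; rewrite /axis_metric /len_dist opprD addrACA subrr addr0.
- exact: len_dist_open.
Qed.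

Lemma axis_metric_eq1 x y :
  axis_metric x y = 1 <->
  exists m : int, [/\ K m, m != 0 & y - x = (m%:~R, 0)].
Proof.
rewrite /axis_metric /len_dist (len_eq1 axis_points0 axis_points_discrete).
have norm_axis (m : int) : `|((m%:~R : R), (0 : R))| = `|m|%:~R.
  by rewrite prod_normE /= normr0 intr_norm; apply/max_idPl.
split=> [[[m Km <-]]|[m [Km m0 ->]]]; rewrite norm_axis ler1z.
- by move=> m1; exists m; split => //; apply/eqP; lia.
- by split; [exists m | lia].
Qed.

Lemma axis_clique k (a b : 'I_k) :
  (forall m : int, `|m| < k%:Z -> K m) -> a != b ->
  axis_metric ((a : nat)%:R, 0) ((b : nat)%:R, 0) = 1.
Proof.
move=> K_big ab; apply/axis_metric_eq1; exists (b%:Z - a%:Z); split.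
- by apply: K_big; have := ltn_ord a; have := ltn_ord b; lia.
- by apply: contra ab => /eqP ab; apply/eqP/val_inj => /=; lia.
- by rewrite intrB -[LHS]/(_ - _, _ - _) subrr.
Qed.

End AxisMetric.

Lemma planar_finite k : (0 < k)%N -> PLANAR R (Finite_chi k).
Proof.
move=> k0; pose K := [set m : int | `|m| < k%:Z].
have K0 : K 0 by rewrite /K /= normr0; lia.
have KN m : K m -> K (- m) by rewrite /K /= normrN.
exists (axis_metric K); first exact: axis_metric_planar.
apply: chromatic_number_finite => [|j]; last first.
  by apply: colorable_clique => a b ab; apply: axis_clique ab.
(* The remainder is nonnegative as [k] is positive, so the absolute value only turns it into a
   natural number. *)
have rem_lt (x : R * R) : (`|(Num.floor x.1 %% k)%Z| < k)%N.
  have := @modz_ge0 (Num.floor x.1) k; have := @ltz_pmod (Num.floor x.1) k.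
  lia.
exists (fun x => Ordinal (rem_lt x)) => x y /axis_metric_eq1-/(_ K0)[m [Km m0]].
move=> /(congr1 fst)/= yx [] rem_eq.
have {}yx : y.1 = x.1 + m%:~R by rewrite -yx addrC subrK.
have floor_y : Num.floor y.1 = Num.floor x.1 + m.
  by rewrite yx floorDrz ?intrKfloor// intr_int.
have : (Num.floor x.1 = Num.floor y.1 %[mod k])%Z.
  have := @modz_ge0 (Num.floor x.1) k; have := @modz_ge0 (Num.floor y.1) k.
  lia.
(* Equal colours make [k] divide [m]; with [|m| < k] this gives [m = 0], contrary to [m0]. *)
move=> /eqP; rewrite eq_sym floor_y eqz_mod_dvd addrAC subrr add0r.
move=> /dvdzP[q mq]; move: Km m0; rewrite /K /= mq normrM.
rewrite (gtr0_norm (_ : 0 < k%:Z))// -[ltRHS]mul1r ltr_pM2r// => q1.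
by rewrite (_ : q = 0) ?mul0r//; lia.
Qed.

Lemma planar_aleph0 : PLANAR R Aleph0.
Proof.
have planar : planar_metric (axis_metric setT) by exact: axis_metric_planar.
exists (axis_metric setT) => //.
apply: chromatic_number_aleph0; last exact: planar_colorable_nat.
(* The points (0, 0), ..., (j, 0) form a clique of size [j.+1]. *)
move=> j Ej; suff: (j.+1 <= j)%N by rewrite ltnn.
by apply: colorable_clique Ej => a b ab; apply: axis_clique ab.
Qed.

End Planar.

Theorem theorem1p1 (R : realType) :
  PLANAR R = [set Finite_chi k | k in [set k : nat | (1 <= k)%N]] `|` [set Aleph0].
Proof.
apply/seteqP; split=> [_ [rho rho_planar <-]|_ [[k k0 <-]| ->]]; last 2 first.
- exact: planar_finite.
- exact: planar_aleph0.
rewrite /chromatic_number; case: pselect => [ex|_]; last first.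
  by rewrite asboolT; [right | exact: planar_colorable_nat].
case: ex_minnP => k /asboolP[c _] _; left; exists k => //=.
(* The plane is nonempty: the colour of the origin witnesses [0 < k]. *)
exact: leq_ltn_trans (ltn_ord (c 0)).
Qed.
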